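(* Let $u_2=\phi(u,u_1)$ be an autonomous second-order ODE, with $\phi$ smooth on an open set $U\subseteq J^1(\mathbb R,\mathbb R)$, and let $(M,g)$ be its associated 3-dimensional Riemannian manifold. Then the leaves of the energy foliation of the ODE are minimal surfaces in $(M,g)$ with constant extrinsic (Gaussian) curvature.
   Context: $J^1(\mathbb R,\mathbb R)$ is the first-order jet bundle, identified with $\mathbb R^3$ with standard coordinates $(x,u,u_1)$. The function $\phi$ is smooth on an open subset $U\subseteq J^1(\mathbb R,\mathbb R)$ and depends only on $(u,u_1)$. The 3-dimensional Riemannian manifold associated with the ODE $u_2=\phi(u,u_1)$ is $M=\{(x,u,u_1)\in U: u_1\neq 0\}$ with the Riemannian metric $$g=(1 + u_1^2)\, dx^2 - 2 u_1\, dx\, du + \left( 1 + \frac{\phi^2}{u_1^2} \right) du^2 - 2 \frac{\phi}{u_1}\, du\, du_1 + du_1^2 .$$ It has the orthonormal frame $e_1=\partial_x+u_1\partial_u+\phi\,\partial_{u_1}$, $e_2=\partial_u+\frac{\phi}{u_1}\partial_{u_1}$, $e_3=\partial_{u_1}$, with dual coframe $\omega^1=dx$, $\omega^2=-u_1\,dx+du$, $\omega^3=-\frac{\phi}{u_1}\,du+du_1$. The energy foliation $\mathcal E$ of the ODE is the foliation of $M$ by surfaces tangent to the involutive distribution $D_p=\{v\in T_pM:\omega^3_p(v)=0\}=\mathrm{span}\{e_1,e_2\}_p$. On a leaf $\Sigma$ (with unit normal $e_3$), let $s_{ij}=g(\nabla_{e_j}e_i,e_3)$, $i,j=1,2$,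 where $\nabla$ is the Levi-Civita connection of $g$; these are the components of the shape operator (second fundamental form). The extrinsic Gaussian curvature is $K_{\mathrm{ext}}=s_{11}s_{22}-s_{12}s_{21}$ and the mean curvature is $H=\frac12(s_{11}+s_{22})$. A surface is minimal if $H\equiv 0$. *)

(* Defs.v *)
From HB Require Import structures.
From mathcomp Require Import all_boot all_order all_algebra.
From mathcomp Require Import all_classical all_reals topology normedtype derive.
Import Order.TTheory GRing.Theory Num.Theory.
Import numFieldNormedType.Exports.

Set Implicit Arguments.
Unset Strict Implicit.
Unset Printing Implicit Defensive.

Local Open Scope classical_set_scope.
Local Open Scope ring_scope.

Section Smooth.
Variables (R : realType) (n : nat) (W : normedModType R).
Implicit Types (U : set 'rV[R]_n.+1) (f : 'rV[R]_n.+1 -> W).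

Definition partial (i : 'I_n.+1) f : 'rV[R]_n.+1 -> W :=
  fun p => 'D_(delta_mx 0 i) f p.

Fixpoint Ck U (k : nat) f : Prop :=
  match k with
  | 0 => forall p, U p -> {for p, continuous f}
  | k'.+1 => (forall p, U p -> differentiable f p) /\
             (forall i, Ck U k' (partial i f))
  end.

Definition smooth_on U f : Prop := forall k, Ck U k f.

End Smooth.

(* Fields on an open subset M of R^3 are total functions; only their values on
   M are meaningful. *)
Section LeviCivita.
Variable R : realType.

Definition vfield := 'rV[R]_3 -> 'rV[R]_3.
Definition metric := 'rV[R]_3 -> 'rV[R]_3 -> 'rV[R]_3 -> R.

Implicit Types (M : set 'rV[R]_3) (f : 'rV[R]_3 -> R) (X Y Z : vfield).

Definition lie_bracket X Y : vfield :=
  fun p => 'D_(X p) Y p - 'D_(Y p) X p.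

Record affine_connection M (nabla : vfield -> vfield -> vfield) : Prop := {
  conn_smooth : forall X Y, smooth_on M X -> smooth_on M Y ->
    smooth_on M (nabla X Y);
  conn_addl : forall X Y Z,
    smooth_on M X -> smooth_on M Y -> smooth_on M Z ->
    forall p, M p ->
      nabla (fun q => X q + Y q) Z p = nabla X Z p + nabla Y Z p;
  conn_scalel : forall f X Y,
    smooth_on M f -> smooth_on M X -> smooth_on M Y ->
    forall p, M p -> nabla (fun q => f q *: X q) Y p = f p *: nabla X Y p;
  conn_addr : forall X Y Z,
    smooth_on M X -> smooth_on M Y -> smooth_on M Z ->
    forall p, M p ->
      nabla X (fun q => Y q + Z q) p = nabla X Y p + nabla X Z p;
  conn_leibniz : forall f X Y,
    smooth_on M f -> smooth_on M X -> smooth_on M Y ->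
    forall p, M p ->
      nabla X (fun q => f q *: Y q) p
      = f p *: nabla X Y p + 'D_(X p) f p *: Y p
}.

Definition torsion_free M (nabla : vfield -> vfield -> vfield) : Prop :=
  forall X Y, smooth_on M X -> smooth_on M Y ->
  forall p, M p -> nabla X Y p - nabla Y X p = lie_bracket X Y p.

Definition metric_compatible M (g : metric)
    (nabla : vfield -> vfield -> vfield) : Prop :=
  forall X Y Z, smooth_on M X -> smooth_on M Y -> smooth_on M Z ->
  forall p, M p ->
    'D_(X p) (fun q => g q (Y q) (Z q)) p
    = g p (nabla X Y p) (Z p) + g p (Y p) (nabla X Z p).

Definition levi_civita M (g : metric)
    (nabla : vfield -> vfield -> vfield) : Prop :=
  [/\ affine_connection M nabla, torsion_free M nabla
    & metric_compatible M g nabla].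

End LeviCivita.

Section Leaves.
Variable R : realType.

(* A local parametrization, given by its domain and its map. *)
Definition patch : Type := set 'rV[R]_2 * ('rV[R]_2 -> 'rV[R]_3).

Definition immersed_patch (c : patch) : Prop :=
  [/\ open c.1, smooth_on c.1 c.2,
      forall q q', c.1 q -> c.1 q' -> c.2 q = c.2 q' -> q = q'
    & forall q, c.1 q -> injective ('d (c.2) q)].

Definition overlap (c d : patch) : set 'rV[R]_2 :=
  c.1 `&` c.2 @^-1` (d.2 @` d.1).

(* A makes S an injectively immersed surface. The surface topology may be finer
   than the subspace topology, so it is Hausdorff; countability of the atlas
   makes it second countable. *)
Definition surface_atlas (S : set 'rV[R]_3) (A : set patch) : Prop :=
  [/\ countable A, forall c, A c -> immersed_patch c,
      S = \bigcup_(c in A) (c.2 @` c.1)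
    & forall c d, A c -> A d ->
        open (overlap c d) /\
        exists tau : 'rV[R]_2 -> 'rV[R]_2,
          smooth_on (overlap c d) tau /\
          forall q, overlap c d q -> d.1 (tau q) /\ d.2 (tau q) = c.2 q].

(* The surface topology is the final one for the parametrizations in A. *)
Definition surface_open (A : set patch) (O : set 'rV[R]_3) : Prop :=
  forall c, A c -> open (c.1 `&` c.2 @^-1` O).

Definition surface_connected (S : set 'rV[R]_3) (A : set patch) : Prop :=
  S !=set0 /\
  forall O, O `<=` S -> surface_open A O -> surface_open A (S `\` O) ->
    O = set0 \/ O = S.

Definition integral_surface (M : set 'rV[R]_3)
    (D : 'rV[R]_3 -> set 'rV[R]_3) (S : set 'rV[R]_3) (A : set patch) : Prop :=
  [/\ S `<=` M, surface_atlas S A, surface_connected S A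
    & forall c, A c -> forall q, c.1 q -> range ('d (c.2) q) = D (c.2 q)].

Definition foliation_leaf (M : set 'rV[R]_3)
    (D : 'rV[R]_3 -> set 'rV[R]_3) (S : set 'rV[R]_3) : Prop :=
  (exists A, integral_surface M D S A) /\
  forall S' A', integral_surface M D S' A' -> S `<=` S' -> S' = S.

End Leaves.

Section EnergyFoliation.
Variable R : realType.
Implicit Types (U : set 'rV[R]_3) (phi : R -> R -> R) (p v w : 'rV[R]_3).

Definition vec3 (a b c : R) : 'rV[R]_3 := \row_(i < 3) [:: a; b; c]`_i.

(* The coordinates (x, u, u_1) of J^1(R, R) = R^3. Applied to a tangent vector
   they are the coordinate differentials dx, du, du_1. *)
Definition cx v : R := v 0 (@Ordinal 3 0 isT).
Definition cu v : R := v 0 (@Ordinal 3 1 isT).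
Definition cu1 v : R := v 0 (@Ordinal 3 2 isT).

Definition ode_rhs phi p : R := phi (cu p) (cu1 p).

Definition ode_manifold U : set 'rV[R]_3 := [set p | U p /\ cu1 p != 0].

(* A term a dy dz of the metric stands for the symmetric product, i.e. the
   bilinear form a / 2 (dy v * dz w + dz v * dy w). *)
Definition ode_metric phi : metric R := fun p v w =>
  (1 + cu1 p ^+ 2) * (cx v * cx w)
  - cu1 p * (cx v * cu w + cu v * cx w)
  + (1 + ode_rhs phi p ^+ 2 / cu1 p ^+ 2) * (cu v * cu w)
  - ode_rhs phi p / cu1 p * (cu v * cu1 w + cu1 v * cu w)
  + cu1 v * cu1 w.

Definition e1 phi : vfield R := fun p => vec3 1 (cu1 p) (ode_rhs phi p).
Definition e2 phi : vfield R := fun p => vec3 0 1 (ode_rhs phi p / cu1 p).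
Definition e3 : vfield R := fun=> vec3 0 0 1.

Definition omega3 phi p v : R := - (ode_rhs phi p / cu1 p) * cu v + cu1 v.

Definition energy_distribution phi p : set 'rV[R]_3 :=
  [set v | omega3 phi p v = 0].

Definition energy_leaf U phi (S : set 'rV[R]_3) : Prop :=
  foliation_leaf (ode_manifold U) (energy_distribution phi) S.

Variables (phi : R -> R -> R) (nabla : vfield R -> vfield R -> vfield R).

(* With the paper's index order, s_ij = shape e_i e_j. *)
Definition shape (X Y : vfield R) p : R :=
  ode_metric phi p (nabla Y X p) (e3 p).

Definition extrinsic_curvature p : R :=
  shape (e1 phi) (e1 phi) p * shape (e2 phi) (e2 phi) p
  - shape (e1 phi) (e2 phi) p * shape (e2 phi) (e1 phi) p.

Definition mean_curvature p : R :=
  2^-1 * (shape (e1 phi) (e1 phi) p + shape (e2 phi) (e2 phi) p).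

Definition minimal_leaf (S : set 'rV[R]_3) : Prop :=
  forall p, S p -> mean_curvature p = 0.

Definition constant_extrinsic_curvature (S : set 'rV[R]_3) : Prop :=
  exists c : R, forall p, S p -> extrinsic_curvature p = c.

End EnergyFoliation.

(* Main.v *)
(** In the orthonormal frame every inner product is constant, so Koszul's formula
    expresses [2 s_ij] through Lie brackets alone. Since [phi] does not depend on
    [x], [e1, e2] is tangent to the leaves, [e3, e2] is a multiple of [e3], and
    [e3, e1] equals [e2] modulo [e3]. Hence [s_11 = s_22 = 0] and
    [s_12 = s_21 = 1/2] on all of [M], so that [H = 0] and [K_ext = - 1/4]. *)

Require Import Defs.
From mathcomp Require Import all_boot all_order all_algebra.
From mathcomp Require Import all_classical all_reals topology normedtype derive.
From mathcomp Require Import landau ring lra.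
Import Order.TTheory GRing.Theory Num.Theory.
Import numFieldNormedType.Exports.

Set Implicit Arguments.
Unset Strict Implicit.
Unset Printing Implicit Defensive.

Local Open Scope classical_set_scope.
Local Open Scope ring_scope.

(** Differentiability at [x] is a first-order expansion with a little-o remainder, which sees only
    values near [x]. The differential of [f] therefore serves for [g], with the same remainder. *)
Lemma near_eq_differentiable (R : numFieldType) (V W : normedModType R)
    (f g : V -> W) (x : V) :
  {near x, f =1 g} -> differentiable f x -> differentiable g x.
Proof.
move=> fg /diff_locallyP[dfc dfE].
have gE : g \o shift x = cst (g x) + 'd f x +o_ 0 id.
  apply/eqaddoP => e e0.
  have /eqaddoP/(_ e e0) fe := dfE.
  have fg0 : \forall h \near (0 : V), f (h + x) = g (h + x).
    move: fg; rewrite [in X in X -> _](near_shift 0 x).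
    by apply: filterS => h /=; rewrite subr0.
  near=> h.
  have -> : (g \o shift x - (cst (g x) + 'd f x)) h
      = (f \o shift x - (cst (f x) + 'd f x)) h.
    rewrite !fctE /= -(nbhs_singleton fg); congr (_ - _).
    by apply/esym; near: h.
  by near: h.
by apply/diff_locallyP; rewrite (diff_unique dfc gE).
Unshelve. all: by end_near. Qed.

Lemma open_near_eq (T : topologicalType) (S : Type) (U : set T) (f g : T -> S) :
  open U -> (forall p, U p -> f p = g p) -> forall p, U p -> {near p, f =1 g}.
Proof.
move=> oU fg p Up; have : nbhs p U by exact: open_nbhs_nbhs.
by rewrite /prop_near1; apply: filterS => q; exact: fg.
Qed.

(** * Closure properties of [Ck] *)

Section Smoothness.
Variables (R : realType) (n : nat).
Implicit Types (W : normedModType R) (U : set 'rV[R]_n.+1).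

(** On an open set, pointwise equality is equality near each point, so it passes to partial
    derivatives. The sum, product and quotient rules below hold only on [U], and this is how they
    enter the inductions. *)
Lemma eq_Ck W U k (f g : 'rV[R]_n.+1 -> W) :
  open U -> (forall p, U p -> f p = g p) -> Ck U k f -> Ck U k g.
Proof.
move=> oU; elim: k f g => [|k IH] f g fg.
  move=> cf p Up.
  move: (cf p Up); rewrite /prop_for /continuous_at -fg// => cfp.
  apply: cvg_trans cfp; apply: (@near_eq_cvg _ _ (nbhs p)).
  exact: (open_near_eq oU fg Up).
have nfg := open_near_eq oU fg.
case=> df pf; split=> [p Up|i].
  exact: near_eq_differentiable (nfg p Up) (df p Up).
by apply: IH (pf i) => p Up; apply: near_eq_derive; exact: nfg.
Qed.

Lemma subset_Ck W U U' k (f : 'rV[R]_n.+1 -> W) :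
  U' `<=` U -> Ck U k f -> Ck U' k f.
Proof.
move=> sU; elim: k f => [|k IH] f; first by move=> cf p /sU; exact: cf.
by case=> df pf; split=> [p /sU|i]; [exact: df | exact: IH (pf i)].
Qed.

Lemma Ck_pred W U k (f : 'rV[R]_n.+1 -> W) : Ck U k.+1 f -> Ck U k f.
Proof.
elim: k f => [|k IH] f [df pf]; last by split=> // i; apply: IH; exact: pf.
by move=> p Up; exact: differentiable_continuous (df p Up).
Qed.

Lemma Ck_cst W U k (c : W) : Ck U k (cst c : 'rV[R]_n.+1 -> W).
Proof.
elim: k c => [|k IH] c; first by move=> p _; exact: cst_continuous.
split=> [p _|i]; first exact: differentiable_cst.
suff -> : partial i (cst c : 'rV[R]_n.+1 -> W) = cst 0 by exact: IH.
by apply/funext => p; exact: derive_cst.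
Qed.

Lemma derive_coord (p v : 'rV[R]_n.+1) (j : 'I_n.+1) :
  'D_v (fun q : 'rV[R]_n.+1 => q 0 j : R) p = v 0 j.
Proof.
have /(congr1 (fun A : 'rV[R]_n.+1 => A 0 j)) :=
  derive_mx (@derivable_id _ _ p v).
by rewrite derive_id mxE => <-.
Qed.

Lemma Ck_coord U k (j : 'I_n.+1) : Ck U k (fun p => p 0 j : R).
Proof.
case: k => [|k]; first by move=> p _; exact: coord_continuous.
split=> [p _|i]; first exact: differentiable_coord.
suff -> : partial i (fun p => p 0 j : R)
    = cst ((delta_mx 0 i : 'rV[R]_n.+1) 0 j).
  exact: Ck_cst.
by apply/funext => p; exact: derive_coord.
Qed.

Lemma Ck_add W U k (f g : 'rV[R]_n.+1 -> W) :
  open U -> Ck U k f -> Ck U k g -> Ck U k (fun p => f p + g p).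
Proof.
move=> oU; elim: k f g => [|k IH] f g.
  by move=> cf cg p Up; apply: continuousD; [exact: cf | exact: cg].
move=> [df pf] [dg pg]; split=> [p Up|i].
  by apply: differentiableD; [exact: df | exact: dg].
apply: (eq_Ck oU _ (IH _ _ (pf i) (pg i))) => p Up.
by rewrite /partial -deriveD//; apply: diff_derivable; [exact: df|exact: dg].
Qed.

Lemma Ck_mul U k (f g : 'rV[R]_n.+1 -> R) :
  open U -> Ck U k f -> Ck U k g -> Ck U k (fun p => f p * g p).
Proof.
move=> oU; elim: k f g => [|k IH] f g.
  by move=> cf cg p Up; apply: continuousM; [exact: cf | exact: cg].
(* Each term of the product rule keeps one factor undifferentiated. [Ck_pred] lowers that factor to
   the order of its partner, so that the induction hypothesis applies. *)
move=> Cf Cg; case: (Cf) (Cg) => df pf [dg pg]; split=> [p Up|i].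
  by apply: differentiableM; [exact: df | exact: dg].
apply: (eq_Ck oU _ (Ck_add oU
  (IH _ _ (Ck_pred Cf) (pg i)) (IH _ _ (Ck_pred Cg) (pf i)))).
move=> p Up; rewrite /partial.
by rewrite [RHS]deriveM//; apply: diff_derivable; [exact: df | exact: dg].
Qed.

Lemma Ck_inv U k (f : 'rV[R]_n.+1 -> R) :
  open U -> (forall p, U p -> f p != 0) -> Ck U k f ->
  Ck U k (fun p => (f p)^-1).
Proof.
move=> oU f0; elim: k => [|k IH].
  by move=> cf p Up; apply: continuousV; [exact: f0 | exact: cf].
move=> Cf; case: (Cf) => df pf; split=> [p Up|i].
  by apply: differentiableV; [exact: df | exact: f0].
(* The partial derivative of [1/f] is [- (1/f)^2] times that of [f], so order [k] of [1/f] itself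
   yields order [k.+1]. *)
have CV := IH (Ck_pred Cf).
apply: (eq_Ck oU _ (Ck_mul oU (Ck_cst U k (- 1 : R))
  (Ck_mul oU (Ck_mul oU CV CV) (pf i)))) => p Up.
rewrite /partial deriveV; [|exact: f0|by apply: diff_derivable; exact: df].
by rewrite /cst /= mulN1r scaleNr -exprVn expr2.
Qed.

Lemma Ck_scale_cst W U k (f : 'rV[R]_n.+1 -> R) (w : W) :
  open U -> Ck U k f -> Ck U k (fun p => f p *: w).
Proof.
move=> oU; elim: k f => [|k IH] f.
  by move=> cf p Up; apply: continuousZr_tmp; exact: cf.
case=> df pf; split=> [p Up|i]; first exact: differentiableZl (df p Up).
apply: (eq_Ck oU _ (IH _ (pf i))) => p Up.
rewrite /partial !deriveE ?diffZl//; try exact: df.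
exact: differentiableZl (df p Up).
Qed.

End Smoothness.

(** * Vector fields given by their coordinates, and the open set [M] *)

Lemma smooth_on_vec3 (R : realType) (M : set 'rV[R]_3) (a b c : 'rV[R]_3 -> R) :
  open M -> smooth_on M a -> smooth_on M b -> smooth_on M c ->
  smooth_on M (fun p => vec3 (a p) (b p) (c p)).
Proof.
move=> oM Ca Cb Cc k.
have -> : (fun p => vec3 (a p) (b p) (c p))
  = fun p => a p *: vec3 1 0 0 + b p *: vec3 0 1 0 + c p *: vec3 0 0 1.
  apply/funext => p; apply/rowP => -[[|[|[|]]] // i3]; rewrite !mxE /=;
  by rewrite !mulr1 !mulr0 ?addr0 ?add0r.
by do !apply: Ck_add => //; exact: Ck_scale_cst.
Qed.

Lemma open_ode_manifold (R : realType) (U : set 'rV[R]_3) :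
  open U -> open (ode_manifold U).
Proof.
move=> oU; apply: openI => //.
apply: (@open_comp _ _ (@cu1 R) [set y | y != 0]); last exact: open_neq.
by move=> p _; exact: coord_continuous.
Qed.

Lemma derive_vec3 (R : realType) (a b c : 'rV[R]_3 -> R) (p v : 'rV[R]_3) :
  differentiable a p -> differentiable b p -> differentiable c p ->
  'D_v (fun q => vec3 (a q) (b q) (c q)) p
  = vec3 ('D_v a p) ('D_v b p) ('D_v c p).
Proof.
move=> da db dc.
have cE i j : (fun q => vec3 (a q) (b q) (c q) i j) = [:: a; b; c]`_j.
  apply/funext => q; rewrite mxE; case: j => -[|[|[|]]] //.
rewrite derive_mx.
  by apply/rowP => j; rewrite !mxE cE; case: j => -[|[|[|]]].
apply/derivable_mxP => i j; rewrite cE.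
by case: j => -[|[|[|]]] // ?; apply: diff_derivable.
Qed.

(** * The orthonormal frame and its derivatives *)

Section EnergyFrame.
Variables (R : realType) (phi : R -> R -> R).
Implicit Types (U : set 'rV[R]_3) (p v w : 'rV[R]_3).

Lemma cx_vec3 (a b c : R) : cx (vec3 a b c) = a. Proof. by rewrite /cx mxE. Qed.
Lemma cu_vec3 (a b c : R) : cu (vec3 a b c) = b. Proof. by rewrite /cu mxE. Qed.
Lemma cu1_vec3 (a b c : R) : cu1 (vec3 a b c) = c.
Proof. by rewrite /cu1 mxE. Qed.
Definition vec3E := (cx_vec3, cu_vec3, cu1_vec3).

Lemma ode_metricC p v w : ode_metric phi p v w = ode_metric phi p w v.
Proof. by rewrite /ode_metric; ring. Qed.

Lemma ode_metricBl p v v' w :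
  ode_metric phi p (v - v') w = ode_metric phi p v w - ode_metric phi p v' w.
Proof. by rewrite /ode_metric /cx /cu /cu1 !mxE; ring. Qed.

(** By orthonormality, pairing with [e1], [e2], [e3] gives the dual coframe; this and the next two
    lemmas turn frame components into coordinate expressions. *)
Lemma ode_metric_e1 p v : cu1 p != 0 -> ode_metric phi p v (e1 phi p) = cx v.
Proof. by move=> y0; rewrite /ode_metric /e1 !vec3E; field. Qed.

Lemma ode_metric_e2 p v : cu1 p != 0 ->
  ode_metric phi p v (e2 phi p) = cu v - cu1 p * cx v.
Proof. by move=> y0; rewrite /ode_metric /e2 !vec3E; field. Qed.

Lemma ode_metric_e3 p v : ode_metric phi p v (e3 p) = omega3 phi p v.
Proof. by rewrite /ode_metric /e3 /omega3 !vec3E; ring. Qed.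

Lemma omega3N p v : omega3 phi p (- v) = - omega3 phi p v.
Proof. by rewrite /omega3 /cu /cu1 !mxE; ring. Qed.

(** This is where autonomy enters: translation in [x] leaves [ode_rhs phi] unchanged, so the
    difference quotient vanishes identically. *)
Lemma derive_cx_ode_rhs p : 'D_(vec3 1 0 0) (ode_rhs phi) p = 0.
Proof.
rewrite /derive [X in X @ _](_ : _ = cst 0); first exact: lim_cst.
apply/funext => h /=.
have -> : ode_rhs phi (h *: vec3 1 0 0 + p) = ode_rhs phi p.
  by rewrite /ode_rhs /cu /cu1 !mxE /= !mulr0 !add0r.
by rewrite subrr scaler0.
Qed.

(** The field [e1] is the [x]-translation field plus [cu1] times [e2], and the former annihilates
    [ode_rhs phi]. *)
Lemma derive_e1_ode_rhs p : cu1 p != 0 -> differentiable (ode_rhs phi) p ->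
  'D_(e1 phi p) (ode_rhs phi) p = cu1 p * 'D_(e2 phi p) (ode_rhs phi) p.
Proof.
move=> y0 dphi; have -> : e1 phi p = vec3 1 0 0 + cu1 p *: e2 phi p.
  rewrite /e1 /e2.
  apply/rowP => -[[|[|[|]]] // i3]; rewrite !mxE /=.
  - by rewrite mulr0 addr0.
  - by rewrite mulr1 add0r.
  - by rewrite add0r mulrC divfK.
rewrite !deriveE// linearD linearZ -!deriveE//.
by rewrite derive_cx_ode_rhs add0r.
Qed.

Lemma derive_e1 p v : differentiable (ode_rhs phi) p ->
  'D_v (e1 phi) p = vec3 0 (cu1 v) ('D_v (ode_rhs phi) p).
Proof.
move=> dphi; rewrite derive_vec3 //; last exact: differentiable_coord.
by rewrite derive_cst derive_coord.
Qed.

Lemma derive_e2 p v : cu1 p != 0 -> differentiable (ode_rhs phi) p ->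
  'D_v (e2 phi) p = vec3 0 0
    ('D_v (ode_rhs phi) p / cu1 p - ode_rhs phi p * cu1 v / cu1 p ^+ 2).
Proof.
move=> y0 dphi.
have dy : differentiable (@cu1 R) p by exact: differentiable_coord.
rewrite derive_vec3 //; last first.
  by apply: differentiableM => //; exact: differentiableV.
rewrite !derive_cst deriveM; [|exact: diff_derivable |];
  last by apply: derivableV => //; exact: diff_derivable.
rewrite deriveV//; last exact: diff_derivable.
rewrite derive_coord; congr vec3.
by rewrite /GRing.scale /= -/(cu1 v); field.
Qed.

(** * Lie brackets of the frame *)

Lemma lie_bracket_e3_e1 p : differentiable (ode_rhs phi) p ->
  lie_bracket (@e3 R) (e1 phi) p = vec3 0 1 ('D_(e3 p) (ode_rhs phi) p).
Proof.
move=> dphi; rewrite /lie_bracket derive_e1// [X in _ - X]derive_cst subr0.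
by rewrite /e3 cu1_vec3.
Qed.

(** Only the last coordinate of [e2] varies, and [e3] is constant. Whatever [d] is, the bracket is
    orthogonal to [e1] and [e2]. *)
Lemma lie_bracket_e3_e2 p : cu1 p != 0 -> differentiable (ode_rhs phi) p ->
  exists d, lie_bracket (@e3 R) (e2 phi) p = vec3 0 0 d.
Proof.
move=> y0 dphi; eexists.
by rewrite /lie_bracket derive_e2// [X in _ - X]derive_cst subr0.
Qed.

(** This is the involutivity of the energy distribution. The terms in [phi ^+ 2 / cu1 ^+ 2] cancel,
    and what remains, [e1(phi) / cu1 - e2(phi)], vanishes by [derive_e1_ode_rhs]. *)
Lemma omega3_lie_bracket_e1_e2 p : cu1 p != 0 ->
  differentiable (ode_rhs phi) p ->
  omega3 phi p (lie_bracket (e1 phi) (e2 phi) p) = 0.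
Proof.
move=> y0 dphi; rewrite /lie_bracket derive_e1// derive_e2//.
rewrite derive_e1_ode_rhs//.
by rewrite /omega3 /cu /cu1 !mxE /= -/(cu1 p); field.
Qed.

Lemma smooth_e1 U : open U -> smooth_on U (ode_rhs phi) ->
  smooth_on U (e1 phi).
Proof.
move=> oU sphi; apply: smooth_on_vec3 => // k; first exact: Ck_cst.
exact: Ck_coord.
Qed.

Lemma smooth_e2 U : open U -> (forall p, U p -> cu1 p != 0) ->
  smooth_on U (ode_rhs phi) -> smooth_on U (e2 phi).
Proof.
move=> oU y0 sphi; apply: smooth_on_vec3 => // k; try exact: Ck_cst.
by apply: Ck_mul => //; apply: Ck_inv => //; exact: Ck_coord.
Qed.

Lemma smooth_e3 U : smooth_on U (@e3 R).
Proof. by move=> k; exact: Ck_cst. Qed.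

End EnergyFrame.

(** * Koszul's formula *)

Lemma lie_bracketC (R : realType) (X Y : vfield R) p :
  lie_bracket X Y p = - lie_bracket Y X p.
Proof. by rewrite /lie_bracket opprB. Qed.

Lemma koszul_cst (R : realType) (M : set 'rV[R]_3) (g : metric R)
    (nabla : vfield R -> vfield R -> vfield R) (X Y Z : vfield R) (a b c : R) :
  open M -> (forall p v w, g p v w = g p w v) ->
  (forall p v v' w, g p (v - v') w = g p v w - g p v' w) ->
  levi_civita M g nabla ->
  smooth_on M X -> smooth_on M Y -> smooth_on M Z ->
  (forall p, M p -> g p (X p) (Y p) = a) ->
  (forall p, M p -> g p (Y p) (Z p) = b) ->
  (forall p, M p -> g p (X p) (Z p) = c) ->
  forall p, M p ->
  2 * g p (nabla X Y p) (Z p) = g p (lie_bracket X Y p) (Z p)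
    + g p (lie_bracket Z X p) (Y p) + g p (lie_bracket Z Y p) (X p).
Proof.
move=> oM gC gB [_ torsion compat] sX sY sZ XYa YZb XZc p Mp.
(* Metric compatibility makes [nabla V] skew when the inner product is constant. Constancy is known
   only on [M]; its openness lets the derivative see a constant function. *)
have compat0 V W W' d : smooth_on M V -> smooth_on M W -> smooth_on M W' ->
    (forall q, M q -> g q (W q) (W' q) = d) ->
    g p (nabla V W p) (W' p) + g p (nabla V W' p) (W p) = 0.
  move=> sV sW sW' WW'; rewrite (gC p (nabla V W' p)) -compat//.
  rewrite (near_eq_derive _ (open_near_eq oM (g := cst d) WW' Mp)).
  exact: derive_cst.
(* With the brackets written as differences of covariant derivatives, the three skew relations for
   directions [X], [Y], [Z] leave a linear identity. *)
rewrite -!torsion// !gB.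
have := compat0 _ _ _ _ sX sY sZ YZb.
have := compat0 _ _ _ _ sY sX sZ XZc.
have := compat0 _ _ _ _ sZ sX sY XYa.
lra.
Qed.

Theorem proposition4p1 (R : realType) (U : set 'rV[R]_3) (phi : R -> R -> R)
    (nabla : vfield R -> vfield R -> vfield R) (Sigma : set 'rV[R]_3) :
  open U ->
  smooth_on U (ode_rhs phi) ->
  levi_civita (ode_manifold U) (ode_metric phi) nabla ->
  energy_leaf U phi Sigma ->
  minimal_leaf phi nabla Sigma /\ constant_extrinsic_curvature phi nabla Sigma.
Proof.
move=> oU sphi LC [[A [SM _ _ _]] _].
have oM := open_ode_manifold oU.
have sM : smooth_on (ode_manifold U) (ode_rhs phi).
  by move=> k; apply: subset_Ck (sphi k) => p [].
have y0 p : ode_manifold U p -> cu1 p != 0 by case.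
have s1 := smooth_e1 oM sM; have s2 := smooth_e2 oM y0 sM.
have s3 : smooth_on (ode_manifold U) (@e3 R) := @smooth_e3 R _.
suff shapes p : ode_manifold U p ->
    [/\ Defs.shape phi nabla (e1 phi) (e1 phi) p = 0,
        Defs.shape phi nabla (e2 phi) (e2 phi) p = 0,
        Defs.shape phi nabla (e1 phi) (e2 phi) p = 2^-1
      & Defs.shape phi nabla (e2 phi) (e1 phi) p = 2^-1].
  split=> [p /SM /shapes [s11 s22 _ _]|].
    by rewrite /mean_curvature s11 s22 addr0 mulr0.
  exists (- (2^-1 * 2^-1)) => p /SM /shapes [s11 s22 s12 s21].
  by rewrite /extrinsic_curvature s11 s22 s12 s21 mul0r sub0r.
have g11 q : ode_manifold U q -> ode_metric phi q (e1 phi q) (e1 phi q) = 1.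
  by move=> /y0 q0; rewrite ode_metric_e1// vec3E.
have g22 q : ode_manifold U q -> ode_metric phi q (e2 phi q) (e2 phi q) = 1.
  by move=> /y0 q0; rewrite ode_metric_e2// !vec3E mulr0 subr0.
have g12 q : ode_manifold U q -> ode_metric phi q (e1 phi q) (e2 phi q) = 0.
  by move=> /y0 q0; rewrite ode_metric_e2// !vec3E mulr1 subrr.
have g13 q : ode_manifold U q -> ode_metric phi q (e1 phi q) (e3 q) = 0.
  by move=> /y0 q0; rewrite ode_metric_e3 /omega3 !vec3E; field.
have g23 q : ode_manifold U q -> ode_metric phi q (e2 phi q) (e3 q) = 0.
  by move=> /y0 q0; rewrite ode_metric_e3 /omega3 !vec3E; field.
have g21 q : ode_manifold U q -> ode_metric phi q (e2 phi q) (e1 phi q) = 0.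
  by rewrite ode_metricC; exact: g12.
move=> Mp; have yp := y0 _ Mp.
have dphi : differentiable (ode_rhs phi) p by case: (sM 1) => /(_ p Mp).
have b31_1 : ode_metric phi p (lie_bracket (@e3 R) (e1 phi) p) (e1 phi p) = 0.
  by rewrite ode_metric_e1// lie_bracket_e3_e1// vec3E.
(* This is the one nonzero bracket component that enters the shape operator; its value comes from
   differentiating the [u]-coordinate [cu1] of [e1] along [e3]. *)
have b31_2 : ode_metric phi p (lie_bracket (@e3 R) (e1 phi) p) (e2 phi p) = 1.
  by rewrite ode_metric_e2// lie_bracket_e3_e1// !vec3E mulr0 subr0.
have [d b32] := lie_bracket_e3_e2 yp dphi.
have b32_1 : ode_metric phi p (lie_bracket (@e3 R) (e2 phi) p) (e1 phi p) = 0.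
  by rewrite ode_metric_e1// b32 vec3E.
have b32_2 : ode_metric phi p (lie_bracket (@e3 R) (e2 phi) p) (e2 phi p) = 0.
  by rewrite ode_metric_e2// b32 !vec3E mulr0 subr0.
have b12_3 : ode_metric phi p (lie_bracket (e1 phi) (e2 phi) p) (e3 p) = 0.
  by rewrite ode_metric_e3 omega3_lie_bracket_e1_e2.
have b21_3 : ode_metric phi p (lie_bracket (e2 phi) (e1 phi) p) (e3 p) = 0.
  rewrite lie_bracketC ode_metric_e3 omega3N omega3_lie_bracket_e1_e2//.
  exact: oppr0.
have bXX_3 X : ode_metric phi p (lie_bracket X X p) (e3 p) = 0.
  rewrite ode_metric_e3 /lie_bracket subrr /omega3 /cu /cu1 !mxE mulr0.
  exact: addr0.
(* Koszul's formula with third field [e3]. The arguments of [shape] are swapped because its second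
   one is the direction of differentiation; hence [s_12] below takes [X] to be [e2] and [Y] to be
   [e1]. *)
have shapeE X Y a b c t u v : smooth_on (ode_manifold U) X ->
    smooth_on (ode_manifold U) Y ->
    (forall q, ode_manifold U q -> ode_metric phi q (X q) (Y q) = a) ->
    (forall q, ode_manifold U q -> ode_metric phi q (Y q) (e3 q) = b) ->
    (forall q, ode_manifold U q -> ode_metric phi q (X q) (e3 q) = c) ->
    ode_metric phi p (lie_bracket X Y p) (e3 p) = t ->
    ode_metric phi p (lie_bracket (@e3 R) X p) (Y p) = u ->
    ode_metric phi p (lie_bracket (@e3 R) Y p) (X p) = v ->
    Defs.shape phi nabla Y X p = 2^-1 * (t + u + v).
  move=> sX sY XYa YZb XZc <- <- <-; rewrite /Defs.shape.
  rewrite -(koszul_cst oM (@ode_metricC R phi) (@ode_metricBl R phi) LC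
    sX sY s3 XYa YZb XZc Mp).
  by rewrite mulKf ?pnatr_eq0.
split.
- rewrite (shapeE _ _ _ _ _ _ _ _ s1 s1 g11 g13 g13 (bXX_3 _) b31_1 b31_1).
  by rewrite !addr0 mulr0.
- rewrite (shapeE _ _ _ _ _ _ _ _ s2 s2 g22 g23 g23 (bXX_3 _) b32_2 b32_2).
  by rewrite !addr0 mulr0.
- rewrite (shapeE _ _ _ _ _ _ _ _ s2 s1 g21 g13 g23 b21_3 b32_1 b31_2).
  by rewrite !add0r mulr1.
- rewrite (shapeE _ _ _ _ _ _ _ _ s1 s2 g12 g23 g13 b12_3 b31_2 b32_1).
  by rewrite add0r addr0 mulr1.
Qed.
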